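(* Let $(W,T)$ be a dual Coxeter system of type $I_2(m)$, $m\ge 3$, and let $w\in W$. Then $w$ is a quasi-Coxeter element in $W$ if and only if $w$ is a Coxeter element in $W$. It follows that $w\in W$ is a parabolic quasi-Coxeter element if and only if $w$ is a parabolic Coxeter element.
   Context: A dual Coxeter system $(W,T)$ of (finite) rank $n$ consists of a group $W$ and a subset $T\subseteq W$ such that there is a subset $S\subseteq T$ with $|S|=n$, $(W,S)$ a Coxeter system, and $T=\{wsw^{-1}\mid w\in W, s\in S\}$. A simple system for $(W,T)$ is any subset $S'\subseteq T$ such that $(W,S')$ is a Coxeter system; all simple systems have the same cardinality $n$. Type $I_2(m)$ means that $W$ is the dihedral group of order $2m$ with its rank $n=2$ Coxeter structure. For $w\in W$, $\mathrm{Red}_T(w)$ denotes the set of all tuples $(t_1,\dots,t_k)\in T^k$ with $w=t_1\cdots t_k$ and $k$ minimal. An element $c\in W$ is a Coxeter element if there is a simple system $\{s_1',\dots,s_n'\}$ for $(W,T)$ with $c=s_1'\cdots s_n'$. An element $w\in W$ is a parabolic Coxeter element if there is a simple system $\{s_1',\dots,s_n'\}$ for $(W,T)$ with $w=s_1'\cdots s_k'$ for some $k\le n$. An element $w\in W$ is a quasi-Coxeter element if there exists $(t_1,\dots,t_n)\in\mathrm{Red}_T(w)$ such that $W=\langle t_1,\dots,t_n\rangle$. It is a parabolic quasi-Coxeter element if there are a simple system $\{s_1',\dots,s_n'\}$ for $(W,T)$, some $k\le n$, and $(t_1,\dots,t_k)\in\mathrm{Red}_T(w)$ such that $\langle t_1,\dots,t_k\rangle=\langle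 s_1',\dots,s_k'\rangle$. *)

(* Defs.v *)
From mathcomp Require Import all_boot all_fingroup all_solvable.

Set Implicit Arguments.
Unset Strict Implicit.
Unset Printing Implicit Defensive.

Local Open Scope group_scope.

(* The value [M s t = 0] encodes m(s, t) = infinity (no relation). *)
Definition coxeter_matrix (gT : finGroupType) (S : {set gT})
    (M : gT -> gT -> nat) : Prop :=
  forall s t, s \in S -> t \in S ->
    M s t = M t s /\ (M s t == 1%N) = (s == t).

(* [W = < S | (s t)^(M s t) = 1 >], expressed by the universal property of the
   presentation; the target [H] ranges over all groups, not only finite ones. *)
Definition coxeter_presentation (gT : finGroupType) (W S : {set gT})
    (M : gT -> gT -> nat) : Prop :=
  [/\ <<S>> = W,
      forall s t, s \in S -> t \in S -> (s * t) ^+ M s t = 1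
    & forall (H : groupType) (f : gT -> H),
        (forall s t, s \in S -> t \in S -> (f s * f t) ^+ M s t = 1) ->
        exists phi : gT -> H,
          {in W &, {morph phi : x y / x * y}} /\ {in S, phi =1 f}].

Definition coxeter_system (gT : finGroupType) (W S : {set gT}) : Prop :=
  exists M, coxeter_matrix S M /\ coxeter_presentation W S M.

Definition dual_coxeter_system (gT : finGroupType) (n : nat)
    (W T : {set gT}) : Prop :=
  exists S : {set gT},
    [/\ S \subset T, #|S| = n, coxeter_system W S
      & T = [set w * s * w^-1 | w in W, s in S]].

Definition simple_system (gT : finGroupType) (W T S : {set gT}) : Prop :=
  S \subset T /\ coxeter_system W S.

Definition type_I2 (gT : finGroupType) (m : nat) (W T : {set gT}) : Prop :=
  dual_coxeter_system 2 W T /\ W \isog 'D_(m.*2).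

Definition Red (gT : finGroupType) (T : {set gT}) (w : gT) (t : seq gT) : Prop :=
  [/\ {subset t <= T}, w = \prod_(x <- t) x
    & forall u : seq gT, {subset u <= T} -> w = \prod_(x <- u) x ->
        size t <= size u].

(* In the next four definitions [n] is the rank of the dual Coxeter system
   [(W, T)]. *)
Definition coxeter_element (gT : finGroupType) (n : nat) (W T : {set gT})
    (c : gT) : Prop :=
  exists s : n.-tuple gT,
    [/\ uniq s, simple_system W T [set x in s] & c = \prod_(x <- s) x].

Definition parabolic_coxeter_element (gT : finGroupType) (n : nat)
    (W T : {set gT}) (w : gT) : Prop :=
  exists (s : n.-tuple gT) (k : nat),
    [/\ uniq s, simple_system W T [set x in s], k <= n
      & w = \prod_(x <- take k s) x].

Definition quasi_coxeter_element (gT : finGroupType) (n : nat)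
    (W T : {set gT}) (w : gT) : Prop :=
  exists t : n.-tuple gT, Red T w t /\ W = <<[set x in t]>>.

Definition parabolic_quasi_coxeter_element (gT : finGroupType) (n : nat)
    (W T : {set gT}) (w : gT) : Prop :=
  exists (s : n.-tuple gT) (k : nat) (t : k.-tuple gT),
    [/\ uniq s, simple_system W T [set x in s], k <= n, Red T w t
      & <<[set x in t]>> = <<[set x in take k s]>>].

(* Main.v *)
Require Import Defs.
From mathcomp Require Import all_boot all_fingroup all_solvable.

(* The reflections in T are involutions lying outside a rotation subgroup R of
   index 2.  Hence a product of two distinct reflections is a nontrivial element
   of R, so it is not a reflection, and has reflection length exactly 2.
   Conversely, any two reflections generating W form a simple system: by the
   normal form x^e (xy)^k, with e in {0, 1} and k modulo #[x * y], W is
   presented by x^2 = y^2 = (xy)^#[x * y] = 1.  So both kinds of elements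
   are the products st of two reflections with <s, t> = W.  In the
   parabolic case only rank 1 is new, where <s> = <t> forces s = t. *)

Set Implicit Arguments.
Unset Strict Implicit.
Unset Printing Implicit Defensive.

Local Open Scope group_scope.

(** * Powers and involutions in an arbitrary group *)

Lemma involution_invg (H : groupType) (a : H) : a ^+ 2 = 1 -> a^-1 = a.
Proof. by move=> a2; apply: mulg1_eq; rewrite -expg2. Qed.

Lemma natexp_mod (H : groupType) (a : H) n k :
  a ^+ n = 1 -> a ^+ (k %% n) = a ^+ k.
Proof.
by move=> an; rewrite {2}(divn_eq k n) expgnDr mulnC expgnA an expg1n mul1g.
Qed.

(* As (a b)^(n + 1) = 1, moving a past (a b)^k multiplies the exponent by n,
   which plays the role of -1. *)
Lemma involution_mul_pow (H : groupType) (a b : H) n e e' k k' :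
  a ^+ 2 = 1 -> b ^+ 2 = 1 -> (a * b) ^+ n.+1 = 1 ->
  a ^+ nat_of_bool e * (a * b) ^+ k * (a ^+ nat_of_bool e' * (a * b) ^+ k') =
  a ^+ nat_of_bool (e (+) e') * (a * b) ^+ ((if e' then k * n else k) + k')%N.
Proof.
move=> a2 b2 rn.
have [aV bV] := (involution_invg a2, involution_invg b2).
case: e' => /=; last by rewrite addbF mul1g -mulgA -expgnDr.
have rV : (a * b) ^+ n = (a * b)^-1.
  by apply/esym/mulg1_eq; rewrite -expgS.
have ra : (a * b) ^+ k * a = a * (a * b) ^+ (k * n)%N.
  rewrite [_ * a in LHS]conjgC conjXg mulnC expgnA rV.
  by rewrite conjgE !mulgA mulVg mul1g invgM aV bV.
rewrite expg1 !mulgA -(mulgA _ _ a) ra !mulgA expgnDr !mulgA; congr (_ * _ * _).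
by case: e => /=; rewrite ?expg1 ?expg0 ?mul1g // -expg2 a2.
Qed.

(** * Groups generated by two involutions *)

Section TwoInvolutions.

Variables (gT : finGroupType) (x y : gT).
Hypotheses (x2 : x ^+ 2 = 1) (y2 : y ^+ 2 = 1).

Let G := <<[set x; y]>>.
Let R := <[x * y]>.

Lemma involution_conj_cycle : (x * y) ^ x = (x * y)^-1.
Proof.
by rewrite conjgE !mulgA mulVg mul1g invgM !involution_invg.
Qed.

Lemma cycle_sub_two_gen : R \subset G.
Proof. by rewrite cycle_subG groupM // mem_gen ?set21 ?set22. Qed.

(** Conjugation by [x] inverts [x * y], so [x] normalizes [R] and the product is a group; it
    contains [y] because it contains [x] and [x * y]. *)
Lemma two_gen_cycle_mul : G = <[x]> * R.
Proof.
rewrite -norm_joinEl; last first.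
  by rewrite norms_cycle involution_conj_cycle groupV cycle_id.
apply/eqP; rewrite eqEsubset (join_subG <[x]>) cycle_sub_two_gen cycle_subG.
rewrite mem_gen ?set21 // !andbT gen_subG; apply/subsetP=> z /set2P[]->.
  by apply: (subsetP (joing_subl _ _)); apply: cycle_id.
rewrite -(@groupMl _ _ x); last first.
  by apply: (subsetP (joing_subl _ _)); apply: cycle_id.
by apply: (subsetP (joing_subr _ _)); apply: cycle_id.
Qed.

Lemma two_gen_normal_form g : g \in G ->
  exists (e : bool) (k : nat), g = x ^+ e * (x * y) ^+ k.
Proof.
rewrite two_gen_cycle_mul => /mulsgP[_ _ /cycleP[i ->] /cycleP[k ->] ->].
by exists (odd i), k; rewrite -modn2 expg_mod.
Qed.

Lemma two_gen_normal_cycle : R <| G.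
Proof.
rewrite /normal cycle_sub_two_gen two_gen_cycle_mul mul_subG ?normG //.
by rewrite norms_cycle involution_conj_cycle groupV cycle_id.
Qed.

Hypothesis G_gt2 : 2 < #|G|.

(* If x were in R, then R = G, and inversion by x would be trivial on R. *)
Lemma involution_notin_cycle : x \notin R.
Proof.
apply: contraL G_gt2 => Rx; rewrite -leqNgt two_gen_cycle_mul.
have -> : <[x]> * R = R by apply: mulSGid; rewrite cycle_subG.
have/cycleP[i xi] := Rx.
have rV : (x * y) ^ x = x * y.
  apply/conjg_fixP/commgP; rewrite [X in commute _ X]xi.
  exact/commuteX/commute_refl.
apply: dvdn_leq => //; rewrite order_dvdn expg2.
by rewrite -[X in X * _]rV involution_conj_cycle mulVg.
Qed.

(** An element of [G] outside [R] is [x * r] with [r] in [R], and [x * r * x * r'] equals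
    [r ^ x * r'], where conjugation by [x] preserves [R]. *)
Lemma mem_cycle_mul g h :
  g \in G -> h \in G -> g \notin R -> h \notin R -> g * h \in R.
Proof.
move=> /two_gen_normal_form[e [k ->]] /two_gen_normal_form[e' [k' ->]].
rewrite !(groupMr _ (mem_cycle _ _)); case: e => [_|]; last by rewrite group1.
case: e' => [_|]; last by rewrite group1.
rewrite !expg1 !mulgA groupMr ?mem_cycle // -mulgA [_ * x]conjgC mulgA.
rewrite -expg2 x2 mul1g conjXg involution_conj_cycle.
by rewrite groupX // groupV cycle_id.
Qed.

Lemma two_gen_normal_form_inj (e e' : bool) k k' :
  x ^+ e * (x * y) ^+ k = x ^+ e' * (x * y) ^+ k' ->
  e = e' /\ k = k' %[mod #[x * y]].
Proof.
move=> E; have ee' : e = e'.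
  have := congr1 (fun g => g \in R) E.
  rewrite !groupMr ?mem_cycle //.
  by case: e e' {E} => [] [] //=;
    rewrite !expg1 expg0 group1 (negPf involution_notin_cycle).
split=> //; move: E; rewrite ee' => /mulgI /eqP.
by rewrite eq_expg_mod_order => /eqP.
Qed.

Lemma involutions_coxeter_system : coxeter_system G [set x; y].
Proof.
have sq s : s \in [set x; y] -> s ^+ 2 = 1 by case/set2P=> ->.
have inv s : s \in [set x; y] -> s^-1 = s.
  by move/sq/involution_invg.
exists (fun s t => #[s * t]); split=> [s t Ss St|].
  split; first by rewrite -orderV invgM !inv.
  by rewrite order_eq1 mulg_eq1 (inv t).
split=> // [s t _ _|H f fM]; first exact: expg_order.
(* The diagonal relation has exponent [#[s * s] = 1], so it says that [f s] squares to 1. *)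
have f2 s : s \in [set x; y] -> f s ^+ 2 = 1.
  move=> Ss; have := fM s s Ss Ss.
  by rewrite -[s * s]expg2 sq // order1 expg1 -expg2.
have [fx2 fy2] := (f2 x (set21 x y), f2 y (set22 x y)).
have rho := fM x y (set21 x y) (set22 x y).
pose nf (p : bool * 'I_#[x * y]) := x ^+ p.1 * (x * y) ^+ p.2.
(* The default 1 is taken only outside [G], where nothing is required of [phi]. *)
pose phi g := if [pick p | nf p == g] is Some p
  then f x ^+ p.1 * (f x * f y) ^+ p.2 else 1.
have phiE (e : bool) k :
    phi (x ^+ e * (x * y) ^+ k) = f x ^+ e * (f x * f y) ^+ k.
  rewrite /phi; case: pickP => [[e' k'] /eqP|].
    case/two_gen_normal_form_inj=> -> /= kk'.
    by rewrite -(natexp_mod _ rho) kk' natexp_mod.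
  have lt_k : k %% #[x * y] < #[x * y] by rewrite ltn_mod.
  by move/(_ (e, Ordinal lt_k)); rewrite /nf /= expg_mod_order eqxx.
exists phi; split=> [g h|s].
  move=> /two_gen_normal_form[e [k ->]] /two_gen_normal_form[e' [k' ->]].
  (* The multiplication law of normal forms holds in [gT] and in [H] with the same [n], hence [phi]
     respects products. *)
  have [n def_n] : exists n, #[x * y] = n.+1.
    by exists #[x * y].-1; rewrite prednK.
  rewrite (involution_mul_pow (n := n)) -?def_n ?expg_order //.
  by rewrite !phiE (involution_mul_pow (n := n)) -?def_n.
case/set2P=> ->.
  by have := phiE true 0%N; rewrite !expg0 !expg1 !mulg1.
(* The normal form of [y] is [x * (x * y)]. *)
have := phiE true 1%N; rewrite !expg1 !mulgA -!expg2 x2 fx2.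
by rewrite !mul1g.
Qed.

End TwoInvolutions.

(** * Reflections and rotations in a rank 2 system *)

Section DihedralSystem.

Variables (gT : finGroupType) (W : {group gT}) (T : {set gT}).
Hypotheses (dualWT : dual_coxeter_system 2 W T) (W_gt2 : 2 < #|W|).

Lemma coxeter_system_sq (A S : {set gT}) s :
  coxeter_system A S -> s \in S -> s ^+ 2 = 1.
Proof.
case=> M [Mat [_ rel _]] Ss; have [_] := Mat s s Ss Ss.
by rewrite eqxx => /eqP Mss; have := rel s s Ss Ss; rewrite Mss expg1 expg2.
Qed.

(** The rotation subgroup [<[a * b]>] is normal and contains neither simple reflection, hence none
    of their conjugates. *)
Lemma reflections_rotation_subgroup : exists R : {group gT},
  [/\ {in T, forall t, [/\ t \in W, t ^+ 2 = 1 & t \notin R]} &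
      {in T &, forall s t, s * t \in R}].
Proof.
have [S [_ /eqP/cards2P[a [b [_ defS]]] cox defT]] := dualWT.
rewrite {S}defS in cox defT.
have a2 := coxeter_system_sq cox (set21 a b).
have b2 := coxeter_system_sq cox (set22 a b).
have defW : <<[set a; b]>> = W by have [M [_ []]] := cox.
have G_gt2 : 2 < #|<<[set a; b]>>| by rewrite defW.
have memT : {in T, forall t,
    [/\ t \in W, t ^+ 2 = 1 & t \notin <[a * b]>]}.
  rewrite defT => _ /imset2P[w s Ww Ss ->].
  have Ws : s \in W by rewrite -defW mem_gen.
  have wsE : w * s * w^-1 = s ^ w^-1 by rewrite conjgE invgK mulgA.
  rewrite wsE groupJ ?groupV //; split=> //.
    by rewrite -conjXg (coxeter_system_sq cox Ss) conj1g.
  rewrite memJ_norm; last first.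
    rewrite groupV; apply: subsetP Ww; rewrite -defW.
    by rewrite normal_norm // two_gen_normal_cycle.
  case/set2P: Ss => ->; first exact: involution_notin_cycle.
  (* Exchanging [a] and [b] replaces the generator [a * b] by its inverse [b * a]. *)
  have := @involution_notin_cycle _ b a b2 a2.
  by rewrite setUC -cycleV invgM !involution_invg //; apply.
exists <[a * b]>%G; split=> // s t /memT[Ws _ Rs] /memT[Wt _ Rt].
by rewrite mem_cycle_mul // defW.
Qed.

Lemma reflection_pair_coxeter s t : s \in T -> t \in T ->
  <<[set s; t]>> = W -> coxeter_system W [set s; t].
Proof.
have [R [memT _]] := reflections_rotation_subgroup.
move=> /memT[_ s2 _] /memT[_ t2 _] defW.
by rewrite -defW; apply: involutions_coxeter_system; rewrite // defW.
Qed.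

(** * Reduced reflection factorizations *)

Lemma Red_nil : Red T 1 [::].
Proof. by split; rewrite ?big_nil. Qed.

Lemma Red_seq1 s : s \in T -> Red T s [:: s].
Proof.
have [R [memT _]] := reflections_rotation_subgroup.
move=> Ts; split; [by move=> z /[!inE]/eqP-> | by rewrite big_seq1 |].
case=> // _; rewrite big_nil => s1.
by have [_ _] := memT s Ts; rewrite s1 group1.
Qed.

Lemma Red_seq2 s t : s \in T -> t \in T -> s != t -> Red T (s * t) [:: s; t].
Proof.
have [R [memT mulT]] := reflections_rotation_subgroup.
move=> Ts Tt ne_st; split; first by move=> z /[!inE] /orP[] /eqP->.
  by rewrite big_cons big_seq1.
(* A shorter word is empty, which forces [s = t], or a single reflection, which cannot lie in
   [R]. *)
case=> [|u []] // sub; rewrite ?big_nil ?big_seq1 => E.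
  have [_ t2 _] := memT t Tt.
  case/eqP: ne_st; apply: (mulIg t).
  by rewrite E -expg2 t2.
have Tu : u \in T by apply: sub; rewrite inE.
by have [_ _] := memT u Tu; rewrite -E mulT.
Qed.

Lemma set_in_seq2 (s t : gT) : [set z in [:: s; t]] = [set s; t].
Proof. by apply/setP=> z; rewrite !inE. Qed.

Lemma simple_system_sub (s : seq gT) :
  simple_system W T [set x in s] -> {subset s <= T}.
Proof. by case=> /subsetP sub _ z sz; apply: sub; rewrite inE. Qed.

(** * Coxeter and quasi-Coxeter elements *)

Lemma coxeter_elementP w : coxeter_element 2 W T w <->
  exists s t, [/\ s \in T, t \in T, <<[set s; t]>> = W & w = s * t].
Proof.
split=> [[[[|s [|t []]] //= sz] [_ ss ->]]|[s [t [Ts Tt defW ->]]]].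
  have sub := simple_system_sub ss.
  exists s, t; rewrite !sub ?inE ?eqxx ?orbT // big_cons big_seq1.
  split=> //; case: ss => _ [M [_ []]].
  by rewrite set_in_seq2.
(* If [s = t], then [W] is generated by one involution and has order at most 2. *)
have ne_st : s != t.
  apply: contraL W_gt2 => /eqP st; rewrite -defW -st setUid -leqNgt.
  have [R [memT _]] := reflections_rotation_subgroup.
  have [_ s2 _] := memT s Ts.
  by rewrite -/(<[s]>) -orderE dvdn_leq // order_dvdn s2.
exists [tuple s; t]; split; rewrite ?big_cons ?big_nil ?mulg1 //=.
  by rewrite inE ne_st.
split; rewrite set_in_seq2; last exact: reflection_pair_coxeter.
by apply/subsetP=> z /set2P[]->.
Qed.

Lemma quasi_coxeter_elementP w : quasi_coxeter_element 2 W T w <->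
  exists s t, [/\ s \in T, t \in T, <<[set s; t]>> = W & w = s * t].
Proof.
split=> [[[[|s [|t []]] //= sz] [[sub -> _] defW]]|].
  exists s, t; rewrite !sub ?inE ?eqxx ?orbT // big_cons big_seq1.
  by rewrite -set_in_seq2 -defW.
(* Passing through a Coxeter element supplies [s != t], which [Red_seq2] needs. *)
move=> /coxeter_elementP[[[|s [|t []]] //= sz] [us ss ->]].
have sub := simple_system_sub ss.
exists [tuple s; t]; split; last by case: ss => _ [M [_ []]].
rewrite big_cons big_seq1; apply: Red_seq2; rewrite ?sub ?inE ?eqxx ?orbT //.
by move: us; rewrite /= inE andbT.
Qed.

Lemma quasi_coxeter_iff w :
  quasi_coxeter_element 2 W T w <-> coxeter_element 2 W T w.
Proof.
by split=> [/quasi_coxeter_elementP|] /coxeter_elementP //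
  /quasi_coxeter_elementP.
Qed.

(** * Parabolic elements *)

Lemma reflection_cycle_inj s t :
  s \in T -> t \in T -> <[s]> = <[t]> -> s = t.
Proof.
have [R [memT _]] := reflections_rotation_subgroup.
move=> /memT[_ s2 Rs] /memT[_ t2 _] eq_st.
have /cycleP[i si] : s \in <[t]> by rewrite -eq_st cycle_id.
(* Only the parity of [i] matters: [s] is [t] or 1, and 1 lies in [R]. *)
have : s = t ^+ odd i by rewrite -modn2 expg_mod.
by case: (odd i) => // s1; case/negP: Rs; rewrite s1 group1.
Qed.

Lemma parabolic_quasi_coxeter_iff w :
  parabolic_quasi_coxeter_element 2 W T w <->
  parabolic_coxeter_element 2 W T w.
Proof.
split=> [[s [k [t [us ss k2 red eqg]]]]|[s [k [us ss k2 ->]]]].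
  have sub := simple_system_sub ss; have [subt def_w _] := red.
  case: k k2 t red eqg subt def_w => [|[|[|//]]] k2 t red eqg subt def_w.
  - exists s, 0%N; split=> //; rewrite def_w tuple0 take0.
    by rewrite !big_nil.
  - exists s, 1%N; split=> //; rewrite {}def_w.
    case: t s {us ss k2 red} sub eqg subt => [[|t []] //= ?] [[|a [|b []]] //= ?].
    move=> sub eqg subt; rewrite !big_seq1; apply: reflection_cycle_inj.
    + by apply: subt; apply: mem_head.
    + by apply: sub; apply: mem_head.
    rewrite /cycle; move: eqg.
    by congr (<<_>> = <<_>>); apply/setP=> z; rewrite !inE.
  (* For [k = 2] the tuple [t] generates all of [W], so [w] is a quasi-Coxeter element. *)
  have /quasi_coxeter_iff[u [uu su ->]] : quasi_coxeter_element 2 W T w.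
    exists t; split=> //; rewrite eqg take_oversize ?size_tuple //.
    by case: ss => _ [M [_ []]].
  by exists u, 2; split=> //; rewrite take_oversize ?size_tuple.
have sub := simple_system_sub ss.
have sz : size (take k s) == k by rewrite size_takel ?size_tuple.
(* The prefix of the simple system is itself a reduced factorization. *)
exists s, k, (Tuple sz); split=> //=.
case: s us ss sub {sz} => [[|a [|b []]] //= ?]; rewrite inE andbT => ne_ab ss sub.
have Ta : a \in T by rewrite sub ?inE ?eqxx.
have Tb : b \in T by rewrite sub ?inE ?eqxx ?orbT.
case: k k2 => [|[|[|//]]] _; rewrite /= ?big_cons ?big_nil ?mulg1.
- exact: Red_nil.
- exact: Red_seq1.
- exact: Red_seq2.
Qed.

End DihedralSystem.

Theorem corollary6p8 (gT : finGroupType) (W : {group gT}) (T : {set gT})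
    (m : nat) (hm : 3 <= m) (hWT : type_I2 m W T) (w : gT) (hw : w \in W) :
  (quasi_coxeter_element 2 W T w <-> coxeter_element 2 W T w) /\
  (parabolic_quasi_coxeter_element 2 W T w <->
   parabolic_coxeter_element 2 W T w).
Proof.
have [dual isoD] := hWT.
have W_gt2 : 2 < #|W|.
  rewrite (card_isog isoD) card_dihedral ?(ltnW hm) //.
  by rewrite (leq_trans hm) // -addnn leq_addr.
by split; [apply: quasi_coxeter_iff | apply: parabolic_quasi_coxeter_iff].
Qed.
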